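(* Let $(U,Y_U,\mathbf 1,\omega)$ be a vertex operator algebra such that $U(1)$ consists of quasi-primary vectors, let $r=\sum_{t\ge0}r^t=\sum_{t\ge0}\sum_{i=1}^{p_t}(\alpha_i^t\otimes\beta_i^t-\beta_i^t\otimes\alpha_i^t)$, with $\alpha_i^t,\beta_i^t\in U(t)$, be a diagonal skewsymmetric two-tensor in $D(U\widehat\otimes U)$, and let $R=r^1=\sum_{i=1}^{p_1}(\alpha_i^1\otimes\beta_i^1-\beta_i^1\otimes\alpha_i^1)\in U(1)\otimes U(1)$. If $r$ is a skewsymmetric solution to the $0$-VOYBE in $U$, then $R$ is a skewsymmetric solution to the classical Yang-Baxter equation in the Lie algebra $U(1)$.
   Context: The base field is $\mathbb C$. A vertex operator algebra (VOA) is understood in the usual sense and is $\mathbb N$-graded, $U=\bigoplus_{n\ge 0}U(n)$, $\dim U(n)<\infty$, $U(n)$ being the eigenspace of $L(0)$ with eigenvalue $n$; $Y_U(a,z)=\sum_m a_m z^{-m-1}$, $Y_U(\omega,z)=\sum_nL(n)z^{-n-2}$. ''$U(1)$ consists of quasi-primary vectors'' means $L(1)U(1)=0$. The first level $U(1)$ is regarded as a Lie algebra with bracket $[a,b]=a_0b$. Classical Yang-Baxter equation (CYBE) in a Lie algebra $\mathfrak g$ for $R=\sum_ix_i\otimes y_i\in\mathfrak g\otimes\mathfrak g$: $[R_{12},R_{13}]+[R_{12},R_{23}]+[R_{13},R_{23}]=0$, i.e. $\sum_{i,j}\big([x_i,x_j]\otimes y_i\otimes y_j+x_i\otimes[y_i,x_j]\otimes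 y_j+x_i\otimes x_j\otimes[y_i,y_j]\big)=0$. $m$-dot products: for $\alpha,\beta\in U$, $m\in\mathbb Z$, $\alpha\cdot_m\beta=\beta_m\alpha$; $\alpha\cdot'_m\beta=\mathrm{Res}_zz^mY_U(e^{zL(1)}(-z^{-2})^{L(0)}\alpha,z^{-1})\beta$; $\alpha\cdot'^{\mathrm{op}}_m\beta=\mathrm{Res}_zz^mY_U(e^{-zL(1)}(-z^{-2})^{L(0)}\beta,-z^{-1})e^{zL(1)}\alpha$. $U\widehat\otimes U=\prod_{p,q\ge0}U(p)\otimes U(q)$, $U^{\widehat\otimes3}=\prod_{p,q,s\ge0}U(p)\otimes U(q)\otimes U(s)$, $D(U\widehat\otimes U)=\prod_tU(t)\otimes U(t)$ (diagonal elements); $r$ is skewsymmetric if $\sigma(r)=-r$ for the flip $\sigma$. For $r=\sum_tr^t$ with $r^t=\sum_ix_i^t\otimes y_i^t\in U(t)\otimes U(t)$ (finite sum for each $t$), put $r_{12}\cdot_mr_{13}=\sum_{t,s}\sum_{i,k}(x_i^t\cdot_mx_k^s)\otimes y_i^t\otimes y_k^s$, $r_{23}\cdot'_mr_{12}=\sum_{q,t}\sum_{l,i}x_i^t\otimes(x_l^q\cdot'_my_i^t)\otimes y_l^q$, $r_{13}\cdot'^{\mathrm{op}}_mr_{23}=\sum_{s,q}\sum_{k,l}x_k^s\otimes x_l^q\otimes(y_k^s\cdot'^{\mathrm{op}}_my_l^q)$, well-defined elements of $U^{\widehat\otimes3}$. A diagonal skewsymmetric $r$ is a skewsymmetric solution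 to the $m$-VOYBE if $r_{12}\cdot_mr_{13}-r_{23}\cdot'_mr_{12}+r_{13}\cdot'^{\mathrm{op}}_mr_{23}=0$. *)

(* Defs.v *)
From HB Require Import structures.
From mathcomp Require Import all_boot all_order all_algebra.
From mathcomp Require Import boolp classical_sets functions cardinality fsbigop.
From mathcomp Require Import reals complex finmap zify ring.

Set Implicit Arguments.
Unset Strict Implicit.
Unset Printing Implicit Defensive.

Import Order.TTheory GRing.Theory Num.Theory.
Local Open Scope classical_set_scope.
Local Open Scope ring_scope.
Local Open Scope quotient_scope.

(** The tensor product of two modules is the quotient of the set of finite
    formal sums of pairs [x (x) y], represented as sequences, by the congruence
    generated by the bilinearity relations.  Scalars are absorbed in the left
    factor of each pair. *)
Inductive tensor_rel (K : comNzRingType) (U V : lmodType K) :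
  seq (U * V) -> seq (U * V) -> Prop :=
| tensor_refl s : tensor_rel s s
| tensor_sym s t : tensor_rel s t -> tensor_rel t s
| tensor_trans s t w : tensor_rel s t -> tensor_rel t w -> tensor_rel s w
| tensor_cat s s' t t' :
    tensor_rel s s' -> tensor_rel t t' -> tensor_rel (s ++ t) (s' ++ t')
| tensor_catC s t : tensor_rel (s ++ t) (t ++ s)
| tensor_zero y : tensor_rel [:: (0, y)] [::]
| tensor_addl x x' y : tensor_rel [:: (x + x', y)] [:: (x, y); (x', y)]
| tensor_addr x y y' : tensor_rel [:: (x, y + y')] [:: (x, y); (x, y')]
| tensor_scale a x y : tensor_rel [:: (a *: x, y)] [:: (x, a *: y)].

Section Tensor.
Context (K : comNzRingType) (U V : lmodType K).
Implicit Types s t : seq (U * V).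

Definition tensor_relb s t : bool := `[< tensor_rel s t >].

Lemma tensor_relb_refl : reflexive tensor_relb.
Proof. by move=> s; apply/asboolP; exact: tensor_refl. Qed.

Lemma tensor_relb_sym : symmetric tensor_relb.
Proof. by move=> s t; apply/asboolP/asboolP => h; exact: tensor_sym. Qed.

Lemma tensor_relb_trans : transitive tensor_relb.
Proof.
move=> t s w /asboolP h1 /asboolP h2; apply/asboolP; exact: tensor_trans h1 h2.
Qed.

Canonical tensor_equiv :=
  EquivRel tensor_relb tensor_relb_refl tensor_relb_sym tensor_relb_trans.

Definition tensor := {eq_quot tensor_equiv}.
HB.instance Definition _ := Choice.on tensor.
HB.instance Definition _ := EqQuotient.on tensor.

Definition tensor_class s : tensor := \pi_tensor s.
Definition tens x y : tensor := tensor_class [:: (x, y)].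

Lemma tensor_classP s t : tensor_class s = tensor_class t <-> tensor_rel s t.
Proof.
by split=> [/eqmodP /asboolP //|h]; apply/eqmodP; exact/asboolP.
Qed.

Lemma tensor_class_repr (u : tensor) : tensor_class (repr u) = u.
Proof. exact: reprK. Qed.

Lemma tensor_rel_repr s : tensor_rel (repr (tensor_class s)) s.
Proof. by apply/tensor_classP; rewrite tensor_class_repr. Qed.

Definition fscale (a : K) s := [seq (a *: p.1, p.2) | p <- s].

Lemma fscale_rel a s t : tensor_rel s t -> tensor_rel (fscale a s) (fscale a t).
Proof.
elim=> {s t} /=.
- by move=> s; exact: tensor_refl.
- by move=> s t _; exact: tensor_sym.
- by move=> s t w _ h1 _; exact: tensor_trans h1.
- by move=> s s' t t' _ h1 _ h2; rewrite /fscale !map_cat; exact: tensor_cat.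
- by move=> s t; rewrite /fscale !map_cat; exact: tensor_catC.
- by move=> y; rewrite scaler0; exact: tensor_zero.
- by move=> x x' y; rewrite scalerDr; exact: tensor_addl.
- by move=> x y y'; exact: tensor_addr.
- by move=> b x y; rewrite scalerA mulrC -scalerA; exact: tensor_scale.
Qed.

Definition tensor_add (u v : tensor) : tensor := tensor_class (repr u ++ repr v).
Definition tensor_scl (a : K) (u : tensor) : tensor :=
  tensor_class (fscale a (repr u)).
Definition tensor_opp (u : tensor) : tensor := tensor_scl (-1) u.

Lemma tensor_addE s t :
  tensor_add (tensor_class s) (tensor_class t) = tensor_class (s ++ t).
Proof. by apply/tensor_classP; apply: tensor_cat; exact: tensor_rel_repr. Qed.

Lemma tensor_sclE a s :
  tensor_scl a (tensor_class s) = tensor_class (fscale a s).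
Proof. by apply/tensor_classP; apply: fscale_rel; exact: tensor_rel_repr. Qed.

Lemma tensor_addrA : associative tensor_add.
Proof.
move=> u v w; rewrite -(tensor_class_repr u) -(tensor_class_repr v).
by rewrite -(tensor_class_repr w) !tensor_addE catA.
Qed.

Lemma tensor_addrC : commutative tensor_add.
Proof.
move=> u v; rewrite -(tensor_class_repr u) -(tensor_class_repr v) !tensor_addE.
exact/tensor_classP/tensor_catC.
Qed.

Lemma tensor_add0r : left_id (tensor_class [::]) tensor_add.
Proof. by move=> u; rewrite -(tensor_class_repr u) tensor_addE. Qed.

Lemma tensor_sclDl (u : tensor) :
  {morph (fun a => tensor_scl a u) : a b / a + b >-> tensor_add a b}.
Proof.
move=> a b; rewrite -(tensor_class_repr u) !tensor_sclE tensor_addE.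
apply/tensor_classP; elim: (repr u) => [|[x y] s ih] /=; first exact: tensor_refl.
rewrite -cat1s -(cat1s _ (_ ++ _)) scalerDl /=.
apply: tensor_trans (tensor_cat (tensor_addl _ _ _) ih) _.
rewrite -(cat1s (a *: x, y) (fscale a s ++ _)) -(cat1s (a *: x, y) [:: _]).
rewrite -!catA; apply: tensor_cat; first exact: tensor_refl.
rewrite catA -(cat1s _ (fscale b s)) catA.
by apply: tensor_cat; [exact: tensor_catC|exact: tensor_refl].
Qed.

Lemma tensor_scl0 (u : tensor) : tensor_scl 0 u = tensor_class [::].
Proof.
rewrite -(tensor_class_repr u) tensor_sclE; apply/tensor_classP.
elim: (repr u) => [|[x y] s ih] /=; first exact: tensor_refl.
rewrite scale0r -[[::]](cats0 [::]) -cat1s.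
by apply: tensor_cat ih; exact: tensor_zero.
Qed.

Lemma tensor_scl1 : left_id 1 tensor_scl.
Proof.
move=> u; rewrite -[u in RHS]tensor_class_repr -{1}(tensor_class_repr u).
rewrite tensor_sclE; congr tensor_class.
by rewrite -[RHS]map_id; apply: eq_map => -[x y] /=; rewrite scale1r.
Qed.

Lemma tensor_addNr : left_inverse (tensor_class [::]) tensor_opp tensor_add.
Proof.
move=> u; rewrite /tensor_opp -{2}(tensor_scl1 u) -tensor_sclDl addNr.
exact: tensor_scl0.
Qed.

HB.instance Definition _ :=
  GRing.isZmodule.Build tensor tensor_addrA tensor_addrC tensor_add0r tensor_addNr.

Lemma tensor_class_cat s t :
  tensor_class (s ++ t) = tensor_class s + tensor_class t.
Proof. exact/esym/tensor_addE. Qed.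

Lemma tensor_sclA a b (u : tensor) :
  tensor_scl a (tensor_scl b u) = tensor_scl (a * b) u.
Proof.
rewrite -(tensor_class_repr u) !tensor_sclE; congr tensor_class.
by rewrite /fscale -map_comp; apply: eq_map => -[x y] /=; rewrite scalerA.
Qed.

Lemma tensor_sclDr : right_distributive tensor_scl +%R.
Proof.
move=> a u v; rewrite -(tensor_class_repr u) -(tensor_class_repr v).
by rewrite -tensor_class_cat !tensor_sclE -tensor_class_cat /fscale map_cat.
Qed.

HB.instance Definition _ := GRing.Zmodule_isLmodule.Build K tensor
  tensor_sclA tensor_scl1 tensor_sclDr tensor_sclDl.

Lemma tensor_class_scale a s :
  tensor_class (fscale a s) = a *: tensor_class s.
Proof. exact/esym/tensor_sclE. Qed.

(** [tsum f u] is [\sum_i f x_i y_i] for [u = \sum_i x_i (x) y_i]: the value of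
    the linear map induced by [f].  It is meaningful only for bilinear [f]. *)
Definition tsum (W : nmodType) (f : U -> V -> W) (u : tensor) : W :=
  \sum_(p <- repr u) f p.1 p.2.

End Tensor.

Arguments tens {K U V}.
Notation "x ⊗ y" := (tens x y) (at level 40, left associativity) : ring_scope.

Section TensorTheory.
Context (K : comNzRingType) (U V : lmodType K).

Lemma tensor_class_sum (s : seq (U * V)) :
  tensor_class s = \sum_(p <- s) p.1 ⊗ p.2.
Proof.
elim: s => [|[x y] s ih]; first by rewrite big_nil.
by rewrite big_cons -ih /= -cat1s tensor_class_cat.
Qed.

Lemma tens_linl (y : V) : linear (fun x : U => x ⊗ y).
Proof.
move=> a x x'; transitivity ((a *: x) ⊗ y + x' ⊗ y).
  by rewrite -tensor_class_cat; exact/tensor_classP/tensor_addl.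
by congr (_ + _); rewrite -tensor_class_scale.
Qed.

Lemma tens_linr (x : U) : linear (fun y : V => x ⊗ y).
Proof.
move=> a y y'; transitivity (x ⊗ (a *: y) + x ⊗ y').
  by rewrite -tensor_class_cat; exact/tensor_classP/tensor_addr.
congr (_ + _); rewrite -tensor_class_scale.
by apply/tensor_classP/tensor_sym/tensor_scale.
Qed.

Lemma tsum_class (W : lmodType K) (f : U -> V -> W) (s : seq (U * V)) :
  (forall y, linear (f^~ y)) -> (forall x, linear (f x)) ->
  tsum f (tensor_class s) = \sum_(p <- s) f p.1 p.2.
Proof.
move=> fl fr.
have fDl x x' y : f (x + x') y = f x y + f x' y.
  by have := fl y 1 x x'; rewrite !scale1r.
have fDr x y y' : f x (y + y') = f x y + f x y'.
  by have := fr x 1 y y'; rewrite !scale1r.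
have f0l y : f 0 y = 0 by apply: (addIr (f 0 y)); rewrite -fDl !add0r.
have f0r x : f x 0 = 0 by apply: (addIr (f x 0)); rewrite -fDr !add0r.
have fZl a x y : f (a *: x) y = a *: f x y.
  by have := fl y a x 0; rewrite f0l !addr0.
have fZr a x y : f x (a *: y) = a *: f x y.
  by have := fr x a y 0; rewrite f0r !addr0.
suff sumE s1 s2 : tensor_rel s1 s2 ->
    \sum_(p <- s1) f p.1 p.2 = \sum_(p <- s2) f p.1 p.2.
  exact/sumE/tensor_rel_repr.
elim=> {s s1 s2}; first by [].
- by move=> ? ? _ ->.
- by move=> ? ? ? _ -> _ ->.
- by move=> ? ? ? ? _ h1 _ h2; rewrite !big_cat /= h1 h2.
- by move=> ? ?; rewrite !big_cat /= addrC.
- by move=> y; rewrite big_seq1 big_nil.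
- by move=> x x' y; rewrite !big_cons !big_nil /= !addr0.
- by move=> x y y'; rewrite !big_cons !big_nil /= !addr0.
- by move=> a x y; rewrite !big_seq1 /= fZl fZr.
Qed.

Definition flip (u : tensor U V) : tensor V U := tsum (fun x y => y ⊗ x) u.

End TensorTheory.

(** The Lie axioms for [br] play no role in the equation itself, so they are
    not required here. *)
Definition CYBE (K : comNzRingType) (g : lmodType K) (br : g -> g -> g)
    (r : tensor g g) : Prop :=
  tsum (fun x y => tsum (fun x' y' =>
      br x x' ⊗ y ⊗ y' + x ⊗ br y x' ⊗ y' + x ⊗ x' ⊗ br y y') r) r = 0.

Definition skew_CYBE_solution (K : comNzRingType) (g : lmodType K)
    (br : g -> g -> g) (r : tensor g g) : Prop :=
  flip r = - r /\ CYBE br r.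

(** [zbin m i] is the binomial coefficient ["m choose i"] for [m] an integer. *)
Definition zbin (K : fieldType) (m : int) (i : nat) : K :=
  (\prod_(j < i) (m - j%:Z)%:~R) / i`!%:R.

Lemma linear_scale (K : pzRingType) (V W : lmodType K) (f : V -> W) :
  linear f -> forall a x, f (a *: x) = a *: f x.
Proof.
move=> fl a x; have f0 : f 0 = 0.
  by have := fl (-1) 0 0; rewrite scaler0 addr0 scaleN1r addNr.
by have := fl a x 0; rewrite f0 !addr0.
Qed.

Section VOAAxioms.
Context (R : realType) (V : lmodType R[i]).

(** [Y a n b] is [a_n b], where [Y(a, z) = \sum_n a_n z ^ (- n - 1)], so that
    [L(n) = omega_(n+1)]. *)
Implicit Types (Y : V -> int -> V -> V) (one omega : V).

Definition virasoro_mode Y omega (n : int) : V -> V := Y omega (n + 1).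

Definition homogeneous Y omega (n : nat) (v : V) : Prop :=
  virasoro_mode Y omega 0 v = n%:R *: v.

(** The sums in the Jacobi identity, stated here in its component form (the
    Borcherds identity), are finite by truncation. *)
Record is_voa Y one omega (c : R[i]) : Prop := IsVOA {
  voa_linl : forall n b, linear (fun a => Y a n b);
  voa_linr : forall a n, linear (Y a n);
  voa_truncation : forall a b, exists N : int, forall n, N <= n -> Y a n b = 0;
  voa_vacuum : forall n b, Y one n b = if n == -1 then b else 0;
  voa_creation : forall a, Y a (-1) one = a;
  voa_creation0 : forall a n, 0 <= n -> Y a n one = 0;
  voa_jacobi : forall (a b v : V) (m n k : int),
    \sum_(i \in [set: nat])
       zbin R[i] m i *: Y (Y a (n + i%:Z) b) (m + k - i%:Z) v =
    \sum_(i \in [set: nat]) ((-1) ^+ i * zbin R[i] n i) *: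
       (Y a (m + n - i%:Z) (Y b (k + i%:Z) v)
        - (-1) ^ n *: Y b (n + k - i%:Z) (Y a (m + i%:Z) v));
  voa_virasoro : forall (m n : int) (v : V),
    let L := virasoro_mode Y omega in
    L m (L n v) - L n (L m v) =
      (m - n)%:~R *: L (m + n) v
      + (if m + n == 0 then (m ^+ 3 - m)%:~R / 12%:R * c else 0) *: v;
  voa_translation : forall a n b,
    Y (virasoro_mode Y omega (-1) a) n b = - n%:~R *: Y a (n - 1) b;
  (* The sum of the eigenspaces of L(0) is automatically direct. *)
  voa_grading : forall v : V, exists (N : nat) (f : nat -> V),
    (forall n, homogeneous Y omega n (f n)) /\ v = \sum_(n < N) f n;
  voa_findim : forall n : nat, exists (d : nat) (e : 'I_d -> V),
    (forall i, homogeneous Y omega n (e i)) /\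
    forall v, homogeneous Y omega n v ->
      exists x : 'I_d -> R[i], v = \sum_i x i *: e i
}.

End VOAAxioms.

Record voa (R : realType) := VOA {
  voa_sort :> lmodType R[i];
  mode : voa_sort -> int -> voa_sort -> voa_sort;
  vacuum : voa_sort;
  conformal : voa_sort;
  central_charge : R[i];
  voaP : is_voa mode vacuum conformal central_charge
}.

Section Grading.
Context (R : realType) (U : voa R).
Implicit Types (v a b : U) (n : nat).

Definition L (n : int) : U -> U := virasoro_mode (@mode R U) (conformal U) n.

Lemma L_linear (n : int) : linear (L n).
Proof. exact: (voa_linr (voaP U)). Qed.

HB.instance Definition _ (n : int) :=
  GRing.isLinear.Build R[i] U U *:%R (L n) (L_linear n).

Definition homog n : {pred U} := [pred v | L 0 v == n%:R *: v].

Lemma homogP n v : reflect (homogeneous (@mode R U) (conformal U) n v) (v \in homog n).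
Proof. exact: eqP. Qed.

Lemma homog_submod n : submod_closed (homog n).
Proof.
split=> [|a u v]; first by rewrite inE linear0 scaler0.
rewrite !inE => /eqP hu /eqP hv; rewrite L_linear hu hv scalerDr !scalerA.
by rewrite (mulrC a).
Qed.

HB.instance Definition _ n :=
  GRing.isSubmodClosed.Build R[i] U (homog n) (homog_submod n).

Record level n := Level { level_val :> U; level_valP : level_val \in homog n }.

HB.instance Definition _ n := [isSub for @level_val n].
HB.instance Definition _ n := [Choice of level n by <:].
HB.instance Definition _ n := [SubChoice_isSubLmodule of level n by <:].

Lemma homog_indep N (f : nat -> U) : (forall n, f n \in homog n) ->
  \sum_(n < N) f n = 0 -> forall n, (n < N)%N -> f n = 0.
Proof.
elim: N f => [//|N ih] f hf; rewrite big_ord_recr /= => h0.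
have fE n : L 0 (f n) = n%:R *: f n by apply/eqP; exact: hf.
have fN n : (n < N)%N -> f n = 0.
  move=> ltnN.
  suff : (n%:R - N%:R : R[i]) *: f n = 0.
    move/eqP; rewrite scaler_eq0 subr_eq0 eqr_nat => /orP[/eqP nN|/eqP //].
    by rewrite nN ltnn in ltnN.
  apply: (ih (fun k => (k%:R - N%:R) *: f k)) ltnN => [k|].
    exact: (rpredZ (V := U)).
  have /(congr1 (L 0)) := h0; rewrite linear0 linearD linear_sum /= fE.
  have -> : f N = - \sum_(i < N) f i.
    by apply/eqP; rewrite -addr_eq0 addrC h0.
  rewrite scalerN scaler_sumr -sumrB => h1; rewrite -[RHS]h1.
  by apply: eq_bigr => i _; rewrite fE scalerBl.
move=> n; rewrite ltnS leq_eqVlt => /orP[/eqP ->|]; last exact: fN.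
move: h0; rewrite big1 ?add0r // => i _; exact: fN.
Qed.

Lemma hcomp_subproof v : exists f : forall n, level n,
  exists N, (forall n, (N <= n)%N -> f n = 0) /\
            v = \sum_(n < N) (f n : U).
Proof.
have [N [f [hf ->]]] := voa_grading (voaP U) v.
have hf' n : f n \in homog n by apply/homogP; exact: hf.
exists (fun n => if (n < N)%N then Level (hf' n) else 0), N; split.
  by move=> n; rewrite leqNgt => /negbTE ->.
by apply: eq_bigr => i _; rewrite ltn_ord.
Qed.

(** [hcomp n v] is the component of [v] in [U(n)]. *)
Definition hcomp n v : level n := sval (cid (hcomp_subproof v)) n.

Lemma hcomp_homog n (v : U) k : v \in homog k ->
  (hcomp n v : U) = if n == k then v else 0.
Proof.
move=> hv; rewrite /hcomp; case: cid => f /= [N [f0 vE]].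
pose g i : U := (f i : U) - (if i == k then v else 0).
have hg i : g i \in homog i.
  apply: (rpredB (V := U)); first exact: level_valP.
  by case: eqP => [->//|_]; exact: (rpred0 (V := U)).
have gE : \sum_(i < maxn N (maxn n k).+1) g i = 0.
  rewrite sumrB (bigID (fun i : 'I_ _ => (i < N)%N)) /= [X in _ + X - _]big1.
    rewrite addr0 -(big_ord_widen _ (fun i => f i : U)) ?leq_maxl // -vE.
    have kM : (k < maxn N (maxn n k).+1)%N.
      by rewrite leq_max [X in _ || X]ltnS leq_maxr orbT.
    rewrite (bigD1 (Ordinal kM)) //= eqxx big1 ?addr0 ?subrr // => i.
    by rewrite -val_eqE /= => /negbTE ->.
  by move=> i; rewrite -leqNgt => /f0 ->.
apply/eqP; rewrite -subr_eq0; apply/eqP.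
apply: (homog_indep hg gE).
by rewrite leq_max [X in _ || X]ltnS leq_maxl orbT.
Qed.

Lemma zbin0z i : zbin R[i] 0 i = (i == 0%N)%:R.
Proof.
case: i => [|i]; first by rewrite /zbin big_ord0 fact0 divr1.
by rewrite /zbin big_ord_recl subr0 !mul0r.
Qed.

Lemma zbin1z i : zbin R[i] 1 i = (i < 2)%N%:R.
Proof.
case: i => [|[|i]]; first by rewrite /zbin big_ord0 fact0 divr1.
  by rewrite /zbin big_ord_recl big_ord0 subr0 !mulr1 divr1.
by rewrite /zbin !big_ord_recl /= subrr !(mul0r, mulr0).
Qed.

Lemma mode_weight p q (n : int) a b : a \in homog p -> b \in homog q ->
  L 0 (mode a n b) = (p%:Z + q%:Z - n - 1)%:~R *: mode a n b.
Proof.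
move=> /homogP ha /homogP hb.
have [linl linr] := (voa_linl (voaP U), voa_linr (voaP U)).
have modeZl d (x : U) m (y : U) : mode (d *: x) m y = d *: mode x m y.
  exact: (linear_scale (linl m y)).
have modeZr d (x : U) m (y : U) : mode x m (d *: y) = d *: mode x m y.
  exact: (linear_scale (linr x m)).
have := voa_jacobi (voaP U) (conformal U) a b 1 0 n.
rewrite (fsbigTE [fset 0%N; 1%N]%fset); last first.
  by move=> i; rewrite !inE zbin1z; case: i => [|[|i]] //; rewrite scale0r.
rewrite (fsbigTE [fset 0%N]%fset); last first.
  by move=> i; rewrite !inE zbin0z => /negbTE ->; rewrite mulr0 scale0r.
rewrite big_fsetU1 ?inE //= !big_seq_fset1 !zbin1z zbin0z /=.
rewrite !scale1r mulr1 expr0 !scale1r.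
have -> : 0 + 0%:Z = 0 :> int by lia.
have -> : 1 + n - 0%:Z = 1 + n by lia.
have -> : 0 + 1%:Z = 1 :> int by lia.
have -> : 1 + n - 1%:Z = n by lia.
have -> : 1 + 0 - 0%:Z = 1 :> int by lia.
have -> : n + 0%:Z = n by lia.
have -> : 0 + n - 0%:Z = n by lia.
have := voa_translation (voaP U) a (1 + n) b.
rewrite /virasoro_mode addNr => ->.
have := ha; rewrite /homogeneous /virasoro_mode add0r => ->.
have := hb; rewrite /homogeneous /virasoro_mode add0r => ->.
rewrite /L /virasoro_mode add0r modeZl modeZr (addrC 1 n) addrK => /esym/eqP.
rewrite subr_eq => /eqP ->; rewrite -!scalerDl; congr (_ *: _).
by rewrite !rmorphB !rmorphD /= opprD; ring.
Qed.

Lemma bracket_subproof (a b : level 1) : mode (a : U) 0 (b : U) \in homog 1.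
Proof.
by rewrite inE (mode_weight 0 (level_valP a) (level_valP b)) subr0 addrK.
Qed.

(** [[a, b] = a_0 b] on [U(1)].  When [U(0)] is not spanned by the vacuum this
    bracket need not be antisymmetric; nothing below depends on it. *)
Definition bracket (a b : level 1) : level 1 := Level (bracket_subproof a b).

End Grading.

Section DotProducts.
Context (R : realType) (U : voa R).

(** A formal series [\sum_k f_k z ^ k] is given by its coefficients.  The series
    combined below are Laurent polynomials in [z], and [L(1)] is locally
    nilpotent, so all the sums have finite support. *)
Definition laurent := int -> U.
Implicit Types (f g : laurent) (a b : U) (m : int).

Definition zconst a : laurent := fun k => if k == 0 then a else 0.

Definition zmul m f : laurent := fun k => f (k - m).

Definition Res f : U := f (-1).

(** [e ^ (eps z L(1)) f(z)] *)
Definition exp_zL1 (eps : R[i]) f : laurent := fun k =>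
  \sum_(j \in [set: nat]) (eps ^+ j / j`!%:R) *: iter j (L 1) (f (k - j%:Z)).

(** [(- z ^ (-2)) ^ L(0) a] *)
Definition mzz_L0 a : laurent := fun k =>
  \sum_(n \in [set n : nat | k = - (2 * n)%N%:Z]) (-1) ^+ n *: (hcomp n a : U).

(** [Y(f(z), eps z ^ (-1)) g(z)] for [eps] a sign: the term of indices [(i, j)]
    contributes [(f_i)_n g_j eps ^ (- n - 1) z ^ (i + j + n + 1)]. *)
Definition Yinv (eps : R[i]) f g : laurent := fun k =>
  \sum_(ij \in [set: int * int])
    let n := k - ij.1 - ij.2 - 1 in
    eps ^ (- n - 1) *: mode (f ij.1) n (g ij.2).

Definition dot m a b : U := mode b m a.

Definition dot' m a b : U :=
  Res (zmul m (Yinv 1 (exp_zL1 1 (mzz_L0 a)) (zconst b))).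

Definition dot'op m a b : U :=
  Res (zmul m (Yinv (-1) (exp_zL1 (-1) (mzz_L0 b)) (exp_zL1 1 (zconst a)))).

End DotProducts.

Section VOYBE.
Context (R : realType) (U : voa R).

(** The diagonal part [\prod_t U(t) (x) U(t)] of the completed tensor square. *)
Definition diagonal := forall t : nat, tensor (level U t) (level U t).

Definition skewsymmetric (r : diagonal) : Prop := forall t, flip (r t) = - r t.

(** The completed tensor cube [\prod_(p, q, s) U(p) (x) U(q) (x) U(s)]. *)
Definition hat3 :=
  forall p q s : nat, tensor (tensor (level U p) (level U q)) (level U s).

(** [x (x) y (x) z] viewed in the completed tensor cube. *)
Definition tens3 (x y z : U) : hat3 :=
  fun p q s => hcomp p x ⊗ hcomp q y ⊗ hcomp s z.

(** Infinite sums in [hat3] are taken componentwise; each component receives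
    finitely many nonzero terms. *)
Definition r12_dot_r13 (m : int) (r : diagonal) : hat3 := fun p q s =>
  \sum_(ts \in [set: nat * nat])
    tsum (fun x y : level U ts.1 => tsum (fun x' y' : level U ts.2 =>
      tens3 (dot m (x : U) (x' : U)) y y' p q s) (r ts.2)) (r ts.1).

Definition r23_dot'_r12 (m : int) (r : diagonal) : hat3 := fun p q s =>
  \sum_(qt \in [set: nat * nat])
    tsum (fun x' y' : level U qt.1 => tsum (fun x y : level U qt.2 =>
      tens3 x (dot' m (x' : U) (y : U)) y' p q s) (r qt.2)) (r qt.1).

Definition r13_dot'op_r23 (m : int) (r : diagonal) : hat3 := fun p q s =>
  \sum_(sq \in [set: nat * nat])
    tsum (fun x y : level U sq.1 => tsum (fun x' y' : level U sq.2 =>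
      tens3 x x' (dot'op m (y : U) (y' : U)) p q s) (r sq.2)) (r sq.1).

Definition VOYBE (m : int) (r : diagonal) : Prop := forall p q s : nat,
  r12_dot_r13 m r p q s - r23_dot'_r12 m r p q s + r13_dot'op_r23 m r p q s = 0.

Definition skew_VOYBE_solution (m : int) (r : diagonal) : Prop :=
  skewsymmetric r /\ VOYBE m r.

End VOYBE.

(* Main.v *)
(** Take the component of the 0-VOYBE in [U(1) (x) U(1) (x) U(1)]: only [r^1]
    contributes, and since [L(1)] kills [U(1)] the two primed products reduce
    there to [- a_0 b] and [b_0 a].  The resulting equation is turned into the
    CYBE by exchanging the outer tensor factors and using the skewsymmetry of
    [R] in both copies; antisymmetry of the bracket is thus never needed. *)
From HB Require Import structures.
From mathcomp Require Import all_boot all_order all_algebra.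
From mathcomp Require Import boolp classical_sets fsbigop.
From mathcomp Require Import reals complex finmap zify.
(* Last, because [classical_sets] also defines a [diagonal]. *)
Require Import Defs.

Set Implicit Arguments.
Unset Strict Implicit.
Unset Printing Implicit Defensive.

Import Order.TTheory GRing.Theory Num.Theory.
Local Open Scope ring_scope.

(** * Calculus of sums over tensors *)

Section Tsum.
Context (K : comNzRingType) (U V : lmodType K).

Lemma tensPl (a : K) (x x' : U) (y : V) :
  (a *: x + x') ⊗ y = a *: (x ⊗ y) + x' ⊗ y.
Proof. exact: tens_linl. Qed.

Lemma tensPr (a : K) (x : U) (y y' : V) :
  x ⊗ (a *: y + y') = a *: (x ⊗ y) + x ⊗ y'.
Proof. exact: tens_linr. Qed.

Lemma tens0l (y : V) : (0 : U) ⊗ y = 0.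
Proof. by rewrite -[0 in LHS](scale0r 0) (linear_scale (tens_linl y)) scale0r. Qed.

Lemma tens0r (x : U) : x ⊗ (0 : V) = 0.
Proof. by rewrite -[0 in LHS](scale0r 0) (linear_scale (tens_linr x)) scale0r. Qed.

Lemma tensNl (x : U) (y : V) : (- x) ⊗ y = - (x ⊗ y).
Proof. by rewrite -scaleN1r (linear_scale (tens_linl y)) scaleN1r. Qed.

Lemma tensNr (x : U) (y : V) : x ⊗ (- y) = - (x ⊗ y).
Proof. by rewrite -scaleN1r (linear_scale (tens_linr x)) scaleN1r. Qed.

Lemma eq_tsum (W : nmodType) (f g : U -> V -> W) (u : tensor U V) :
  (forall x y, f x y = g x y) -> tsum f u = tsum g u.
Proof. by move=> fg; apply: eq_bigr. Qed.

Lemma tsum0 (W : nmodType) (f : U -> V -> W) (u : tensor U V) :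
  (forall x y, f x y = 0) -> tsum f u = 0.
Proof. by move=> f0; apply: big1. Qed.

Lemma tsumD (W : nmodType) (f g : U -> V -> W) (u : tensor U V) :
  tsum (fun x y => f x y + g x y) u = tsum f u + tsum g u.
Proof. exact: big_split. Qed.

Lemma tsumN (W : zmodType) (f : U -> V -> W) (u : tensor U V) :
  tsum (fun x y => - f x y) u = - tsum f u.
Proof. exact: sumrN. Qed.

Lemma tsum_exchange (U' V' : lmodType K) (W : nmodType)
    (f : U -> V -> U' -> V' -> W) (u : tensor U V) (v : tensor U' V') :
  tsum (fun x y => tsum (f x y) v) u =
  tsum (fun x' y' => tsum (fun x y => f x y x' y') u) v.
Proof. exact: exchange_big. Qed.

Lemma linear_tsum (U' W : lmodType K) (f : U' -> U -> V -> W) (u : tensor U V) :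
  (forall x y, linear (fun z => f z x y)) -> linear (fun z => tsum (f z) u).
Proof.
move=> fl a z z'; rewrite /tsum scaler_sumr -big_split.
by apply: eq_bigr => p _; rewrite fl.
Qed.

Section Bilinear.
Context (W : lmodType K) (f : U -> V -> W).
Hypotheses (fl : forall y, linear (f^~ y)) (fr : forall x, linear (f x)).

(** The representative chosen for a sum is unrelated to those of its summands. Bilinearity frees the
    value from that choice, and the concatenation, with the first part scaled, may be used
    instead. *)
Lemma tsum_linear : linear (tsum f).
Proof.
move=> a u v; rewrite -(tensor_class_repr u) -(tensor_class_repr v).
rewrite -tensor_class_scale -tensor_class_cat !tsum_class // big_cat big_map.
rewrite scaler_sumr; congr (_ + _); apply: eq_bigr => p _.
exact: (linear_scale (fl p.2)).
Qed.

Lemma tsum_tens x y : tsum f (x ⊗ y) = f x y.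
Proof. by rewrite tsum_class // big_seq1. Qed.

End Bilinear.

End Tsum.

(** * Sums over a skewsymmetric tensor *)

Section Skew.
Context (K : comNzRingType) (g W : lmodType K) (r : tensor g g).
Hypothesis r_skew : flip r = - r.

(** Swapping the arguments of [f] amounts to evaluating the linear map [tsum f] at [flip r], which
    is [- r]. *)
Lemma tsum_skew (f : g -> g -> W) :
  (forall y, linear (f^~ y)) -> (forall x, linear (f x)) ->
  tsum f r = - tsum (fun x y => f y x) r.
Proof.
move=> fl fr; have -> : tsum (fun x y => f y x) r = tsum f (flip r).
  have lin_f := tsum_linear fl fr.
  have f_add : {morph tsum f : u v / u + v >-> u + v}.
    by move=> u v; have := lin_f 1 u v; rewrite !scale1r.
  have f0 : tsum f 0 = 0 by rewrite -(scale0r 0) (linear_scale lin_f) scale0r.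
  rewrite /flip [X in _ = tsum f X]/tsum (big_morph _ f_add f0).
  by apply: eq_bigr => p _; rewrite tsum_tens.
by rewrite r_skew -(scaleN1r r) (linear_scale (tsum_linear fl fr)) scaleN1r opprK.
Qed.

(** Each copy of [r] is flipped, and the two signs cancel; exchanging the copies as well reverses
    the whole word [x y x' y']. *)
Lemma tsum_skew2 (f : g -> g -> g -> g -> W) :
  (forall y x' y', linear (fun x => f x y x' y')) ->
  (forall x x' y', linear (fun y => f x y x' y')) ->
  (forall x y y', linear (fun x' => f x y x' y')) ->
  (forall x y x', linear (f x y x')) ->
  tsum (fun x y => tsum (f x y) r) r =
  tsum (fun x y => tsum (fun x' y' => f y' x' y x) r) r.
Proof.
move=> f1 f2 f3 f4; rewrite tsum_skew; last 2 first.
- by move=> y; apply: linear_tsum.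
- by move=> x; apply: linear_tsum.
rewrite [RHS]tsum_exchange -tsumN.
by apply: eq_tsum => x y; rewrite tsum_skew ?opprK.
Qed.

End Skew.

(** * Exchange of the outer factors of the tensor cube *)

Section Flip13.
Context (K : comNzRingType) (g : lmodType K).

Definition flip13 (u : tensor (tensor g g) g) : tensor (tensor g g) g :=
  tsum (fun v z => tsum (fun x y => z ⊗ y ⊗ x) v) u.

Let flip13_linl (z : g) :
  linear (tsum (fun x y : g => z ⊗ y ⊗ x)).
Proof. by apply: tsum_linear => ? ? ? ?; rewrite ?tensPr ?tensPl. Qed.

Let flip13_linr (v : tensor g g) :
  linear (fun z : g => tsum (fun x y : g => z ⊗ y ⊗ x) v).
Proof. by apply: linear_tsum => ? ? ? ? ?; rewrite !tensPl. Qed.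

Lemma flip13_linear : linear flip13.
Proof. exact: tsum_linear flip13_linl flip13_linr. Qed.

HB.instance Definition _ :=
  GRing.isLinear.Build K _ _ *:%R flip13 flip13_linear.

Lemma flip13_tens x y z : flip13 (x ⊗ y ⊗ z) = z ⊗ y ⊗ x.
Proof.
rewrite /flip13 tsum_tens // tsum_tens //.
  by move=> ? ? ? ?; rewrite tensPr.
by move=> ? ? ? ?; rewrite tensPr tensPl.
Qed.

(** [flip13] followed by the reversal of [x y x' y'] from [tsum_skew2] sends the three sums to the
    third, second and first sums of the CYBE, with the arguments of every bracket in the right
    order. *)
Lemma CYBE_of_flipped (br : g -> g -> g) (r : tensor g g) :
  (forall y, linear (br^~ y)) -> (forall x, linear (br x)) ->
  flip r = - r ->
  tsum (fun x y => tsum (fun x' y' => br x' x ⊗ y ⊗ y') r) r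
  + tsum (fun x y => tsum (fun x' y' => x ⊗ br x' y ⊗ y') r) r
  + tsum (fun x y => tsum (fun x' y' => x ⊗ x' ⊗ br y' y) r) r = 0 ->
  CYBE br r.
Proof.
move=> brl brr r_skew /(congr1 flip13); rewrite linear0 !linearD /= /CYBE.
have rev (f h : g -> g -> g -> g -> tensor (tensor g g) g) :
    (forall y x' y', linear (fun x => h x y x' y')) ->
    (forall x x' y', linear (fun y => h x y x' y')) ->
    (forall x y y', linear (fun x' => h x y x' y')) ->
    (forall x y x', linear (h x y x')) ->
    (forall x y x' y', flip13 (f x y x' y') = h y' x' y x) ->
    tsum (fun x y => tsum (h x y) r) r =
    flip13 (tsum (fun x y => tsum (f x y) r) r).
  move=> h1 h2 h3 h4 fh; rewrite tsum_skew2 // [X in flip13 X]/tsum linear_sum.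
  apply: eq_bigr => p _; rewrite linear_sum; apply: eq_bigr => q _.
  by rewrite /= fh.
have brPl a x x' y : br (a *: x + x') y = a *: br x y + br x' y by exact: brl.
have brPr a x y y' : br x (a *: y + y') = a *: br x y + br x y' by exact: brr.
(* The three summands of [E] are put in reverse order, since [flip13] has interchanged the first and
   the last. *)
move=> E; rewrite -[RHS]E [RHS]addrC [X in _ = _ + X]addrC addrA.
transitivity
  (tsum (fun x y => tsum (fun x' y' => br x x' ⊗ y ⊗ y') r) r
   + tsum (fun x y => tsum (fun x' y' => x ⊗ br y x' ⊗ y') r) r
   + tsum (fun x y => tsum (fun x' y' => x ⊗ x' ⊗ br y y') r) r).
  by rewrite -!tsumD; apply: eq_tsum => x y; rewrite !tsumD.
by congr (_ + _ + _); apply: rev => *; rewrite ?flip13_tens // => ? ? ?;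
   rewrite ?brPl ?brPr ?tensPl ?tensPr ?tensPl.
Qed.

End Flip13.

(** * The three products on weight-one vectors *)

Section WeightOne.
Context (R : realType) (U : voa R).
Implicit Types a b : level U 1.

Lemma hcomp_level n k (v : level U k) :
  (hcomp n (v : U) : U) = if n == k then v : U else 0.
Proof. exact: hcomp_homog (level_valP v). Qed.

Lemma hcomp_id k (v : level U k) : hcomp k (v : U) = v.
Proof. by apply: val_inj; rewrite /= hcomp_level eqxx. Qed.

Lemma hcomp_ne n k (v : level U k) : n != k -> hcomp n (v : U) = 0.
Proof. by move=> nk; apply: val_inj; rewrite /= hcomp_level (negbTE nk). Qed.

Lemma bracket_linl b : linear (fun a => bracket a b).
Proof. by move=> c a a'; apply: val_inj; exact: (voa_linl (voaP U)). Qed.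

Lemma bracket_linr a : linear (bracket a).
Proof. by move=> c b b'; apply: val_inj; exact: (voa_linr (voaP U)). Qed.

Lemma mode0l (b : U) n : mode 0 n b = 0.
Proof.
by have := linear_scale (voa_linl (voaP U) n b) 0 0; rewrite !scale0r.
Qed.

Lemma mode0r (a : U) n : mode a n 0 = 0.
Proof.
by have := linear_scale (voa_linr (voaP U) a n) 0 0; rewrite !scale0r.
Qed.

(** The monomial [v z ^ n]; [zconst v] is convertible to [zmono 0 v]. *)
Definition zmono (n : int) (v : U) : laurent U :=
  fun k => if k == n then v else 0.

Lemma Yinv_zmono (eps : R[i]) m n (u v : U) k :
  Yinv eps (zmono m u) (zmono n v) k =
  eps ^ (- (k - m - n)) *: mode u (k - m - n - 1) v.
Proof.
rewrite /Yinv (fsbigTE [fset (m, n)]%fset) => [|[i j]].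
  rewrite big_seq_fset1 /zmono /= !eqxx; congr (eps ^ _ *: _); lia.
rewrite !inE xpair_eqE /zmono /=; case: eqP => [_ /= /negbTE ->|_ _].
  by rewrite mode0r scaler0.
by rewrite mode0l scaler0.
Qed.

Lemma exp_zL1_zmono (eps : R[i]) n (v : U) : L 1 v = 0 ->
  exp_zL1 eps (zmono n v) = zmono n v.
Proof.
move=> Lv; apply/funext => k.
rewrite /exp_zL1 (fsbigTE [fset 0%N]%fset) => [|[|j]]; last 2 first.
- by rewrite inE.
(* The innermost [L 1] already kills the coefficient, so only [j = 0] survives in the
   exponential. *)
- move=> _; rewrite iterSr (_ : L 1 _ = 0) ?iter_fix ?linear0 ?scaler0 //.
  by rewrite /zmono; case: ifP; rewrite ?linear0.
by rewrite big_seq_fset1 /= expr0 fact0 divr1 scale1r subr0.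
Qed.

Lemma mzz_L0_level t (a : level U t) :
  mzz_L0 (a : U) = zmono (- (2 * t)%N%:Z) ((-1) ^+ t *: (a : U)).
Proof.
apply/funext => k; rewrite /mzz_L0 /zmono.
have [->|kN] := eqVneq k.
  rewrite (fsbigE [:: t]) //=; last 2 first.
  - by move=> n /=; rewrite inE => /eqP ->.
  - by move=> n /= /eqP + /negP []; rewrite inE; lia.
  by rewrite big_cons big_nil mem_set //= addr0 hcomp_level eqxx.
rewrite fsbig1 // => n /= kE; rewrite hcomp_level ifN ?scaler0 //.
by apply: contraNneq kN => <-; rewrite kE.
Qed.

Context (quasi_primary : forall a, L 1 (a : U) = 0).

Lemma exp_mzz_level1 (eps : R[i]) a :
  exp_zL1 eps (mzz_L0 (a : U)) = zmono (-2) (- (a : U)).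
Proof.
rewrite mzz_L0_level expr1 scaleN1r exp_zL1_zmono //.
by rewrite linearN /= quasi_primary oppr0.
Qed.

Lemma modeNl (x : U) n (y : U) : mode (- x) n y = - mode x n y.
Proof.
by rewrite -scaleN1r (linear_scale (voa_linl (voaP U) n y)) scaleN1r.
Qed.

(** The series inserted is [- a z ^ (-2)]; in the coefficient of [z ^ (-1)] the mode index is
    [-1 + 2 - 0 - 1 = 0]. *)
Lemma dot'_level1 a b : dot' 0 (a : U) (b : U) = - (bracket a b : U).
Proof.
rewrite /dot' /Res /zmul exp_mzz_level1 -[zconst _]/(zmono 0 (b : U)).
by rewrite Yinv_zmono modeNl exp1rz scale1r.
Qed.

(** The mode index is again 0, but the argument [- z ^ (-1)] contributes [(-1) ^ (-1)], which
    cancels the sign of [- b z ^ (-2)]. *)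
Lemma dot'op_level1 a b : dot'op 0 (a : U) (b : U) = bracket b a :> U.
Proof.
rewrite /dot'op /Res /zmul exp_mzz_level1 -[zconst _]/(zmono 0 (a : U)).
rewrite exp_zL1_zmono // Yinv_zmono modeNl /=.
by rewrite -exprnN expr1 invrN1 scaleN1r opprK.
Qed.

Lemma tsum2_level1 (f : U -> U -> U -> U -> hat3 U) (r : diagonal U) :
  (forall t s (x y : level U t) (x' y' : level U s),
     (t, s) != (1%N, 1%N) -> f x y x' y' 1%N 1%N 1%N = 0) ->
  \sum_(ts \in [set: nat * nat])
    tsum (fun x y : level U ts.1 => tsum (fun x' y' : level U ts.2 =>
      f x y x' y' 1%N 1%N 1%N) (r ts.2)) (r ts.1) =
  tsum (fun x y : level U 1 => tsum (fun x' y' : level U 1 =>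
      f x y x' y' 1%N 1%N 1%N) (r 1%N)) (r 1%N).
Proof.
move=> f0; rewrite (fsbigTE [fset (1%N, 1%N)]%fset) ?big_seq_fset1 // => ts.
rewrite inE => ts1; apply: tsum0 => x y; apply: tsum0 => x' y'.
by apply: f0; rewrite -surjective_pairing.
Qed.

Lemma CYBE_of_VOYBE (r : diagonal U) :
  skewsymmetric r -> VOYBE 0 r -> CYBE (@bracket R U) (r 1%N).
Proof.
move=> r_skew /(_ 1%N 1%N 1%N).
rewrite /r12_dot_r13 /r23_dot'_r12 /r13_dot'op_r23.
(* In each product one factor of either copy of [r] stays untouched. Its weight is the index of that
   copy, so the component of weight (1, 1, 1) forces both indices to be 1. *)
have ne1 t s (x : level U t) (y : level U s) : (t, s) != (1%N, 1%N) ->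
    hcomp 1 (x : U) = 0 \/ hcomp 1 (y : U) = 0.
  rewrite xpair_eqE negb_and eq_sym (eq_sym s).
  by case/orP => /hcomp_ne; [left|right].
rewrite (tsum2_level1 (f := fun x y x' y' => tens3 (dot 0 x x') y y')); last first.
  by move=> t s x y x' y' /(ne1 _ _ y y')[] h; rewrite /tens3 h ?tens0r ?tens0l.
rewrite (tsum2_level1 (f := fun x' y' x y => tens3 x (dot' 0 x' y) y')); last first.
  (* The outer copy is now [r_23], so the untouched factors are the second of the outer pair and the
     first of the inner pair. *)
  by move=> t s x y x' y' /(ne1 _ _ y x')[] h; rewrite /tens3 h ?tens0r ?tens0l.
rewrite (tsum2_level1 (f := fun x y x' y' => tens3 x x' (dot'op 0 y y'))); last first.
  by move=> t s x y x' y' /(ne1 _ _ x x')[] h; rewrite /tens3 h ?tens0r ?tens0l.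
move=> E; apply: CYBE_of_flipped (r_skew 1%N) _.
- exact: bracket_linl.
- exact: bracket_linr.
rewrite -[RHS]E -tsumN; congr (_ + _ + _).
- apply: eq_tsum => x y; apply: eq_tsum => x' y'.
  by rewrite /tens3 !hcomp_id -[dot _ _ _]/(bracket x' x : U) hcomp_id.
(* The middle term of the VOYBE sums over [r_23] first, hence the exchange; its minus sign cancels
   the one in [dot'_level1]. *)
- rewrite tsum_exchange; apply: eq_tsum => x' y'; rewrite -tsumN.
  apply: eq_tsum => x y; rewrite /tens3 !hcomp_id dot'_level1.
  rewrite -[- level_val _]/(level_val (- bracket x' y)) hcomp_id.
  by rewrite tensNr tensNl opprK.
- apply: eq_tsum => x y; apply: eq_tsum => x' y'.
  by rewrite /tens3 !hcomp_id dot'op_level1 hcomp_id.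
Qed.

End WeightOne.

Theorem lemma4p1 (R : realType) (U : voa R)
    (quasi_primary : forall a : level U 1, L 1 (a : U) = 0)
    (p : nat -> nat) (alpha beta : forall t : nat, 'I_(p t) -> level U t)
    (r : diagonal U)
    (rE : forall t : nat, r t =
       \sum_(i < p t) (alpha t i ⊗ beta t i - beta t i ⊗ alpha t i)) :
  skew_VOYBE_solution 0 r ->
  skew_CYBE_solution (@bracket R U)
    (\sum_(i < p 1%N) (alpha 1%N i ⊗ beta 1%N i - beta 1%N i ⊗ alpha 1%N i)).
Proof.
move=> [r_skew r_voybe]; rewrite -rE.
by split; [exact: r_skew|exact: CYBE_of_VOYBE].
Qed.
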